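(* There exists a universal constant $C>0$ such that the following holds. Let $n\geq 1$ and $1\leq k\leq n$ be integers. Let $\lambda\vdash n$ and $\mu\vdash k$ be such that $\mu\subset\lambda$. Then $$\frac{d_{\lambda\setminus\mu}}{d_\lambda}\leq\left(C\max\left(\frac{1}{\sqrt{k}},\frac{s(\lambda)}{n}\right)\right)^k.$$
   Context: Partitions are identified with their Young diagrams, and $\mu\subset\lambda$ means containment of diagrams. $d_\lambda$ is the number of standard Young tableaux of shape $\lambda$, and $d_{\lambda\setminus\mu}$ is the number of standard tableaux of the skew diagram $\lambda\setminus\mu$ (fillings of the boxes of $\lambda$ not in $\mu$ with the numbers $1,\dots,|\lambda|-|\mu|$, each used once, increasing along rows and columns; it equals $1$ if $\mu=\lambda$). $s(\lambda):=\lambda_1+\lambda_1'-1$ is the maximal hook length of $\lambda$, where $\lambda_1$ and $\lambda_1'$ are the lengths of its first row and first column. *)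

(* Defs.v *)
From mathcomp Require Import all_boot all_order all_algebra.
From mathcomp Require Import reals.
Set Implicit Arguments.
Unset Strict Implicit.
Unset Printing Implicit Defensive.

(* The positive parts of the partition, listed in weakly decreasing order. *)
Definition is_partition_of (n : nat) (lam : seq nat) : bool :=
  [&& sorted geq lam, 0 \notin lam & sumn lam == n].

(* Boxes are pairs (row, column), both numbered from 0. *)
Definition diagram (lam : seq nat) : pred (nat * nat) :=
  [pred c | c.2 < nth 0 lam c.1].

Definition skew_diagram (lam mu : seq nat) : pred (nat * nat) :=
  [pred c | (c \in diagram lam) && (c \notin diagram mu)].

(* When lam is a partition, its diagram lies in the rectangle with size lam    *)
(* rows and head 0 lam columns, so this type contains every box of lam \ mu.   *)
Definition skew_box (lam mu : seq nat) :=
  {c : 'I_(size lam) * 'I_(head 0 lam) |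
    (val c.1, val c.2) \in skew_diagram lam mu}.

Definition row_of lam mu (b : skew_box lam mu) : nat := (val b).1.
Definition col_of lam mu (b : skew_box lam mu) : nat := (val b).2.

(* Entries are 0, ..., m - 1 instead of 1, ..., m. *)
Definition is_standard (lam mu : seq nat) (m : nat)
    (t : {ffun skew_box lam mu -> 'I_m}) : bool :=
  [&& [forall v : 'I_m, #|[set b | t b == v]| == 1],
      [forall b, forall b',
         (row_of b == row_of b') && (col_of b < col_of b') ==> (t b < t b')]
    & [forall b, forall b',
         (col_of b == col_of b') && (row_of b < row_of b') ==> (t b < t b')]].

Definition num_skew_syt (lam mu : seq nat) : nat :=
  #|[set t : {ffun skew_box lam mu -> 'I_(sumn lam - sumn mu)}
      | is_standard t]|.

Definition num_syt (lam : seq nat) : nat := num_skew_syt lam [::].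

(* As the parts are positive, the first column of lam has size lam boxes. *)
Definition max_hook (lam : seq nat) : nat := head 0 lam + size lam - 1.

(* Main.v *)
Require Import Defs.
From mathcomp Require Import all_boot all_order fingroup perm all_algebra.
From mathcomp Require Import ring lra zify.
From mathcomp Require Import reals.
From mathcomp Require Import sequences exp.
Set Implicit Arguments.
Unset Strict Implicit.
Unset Printing Implicit Defensive.
Import Order.TTheory GRing.Theory Num.Theory.

(* With l_i = lambda_i + r - i, m_j = mu_j + r - j and x^_m the falling        *)
(* factorial, the determinants D(mu) = det (l_i ^_ m_j) satisfy                 *)
(* (n - |mu|) D(mu) = \sum_k D(mu + e_k) and vanish when mu is not contained in *)
(* lambda, so that d_{lambda/mu} / d_lambda = (n-k)!/n! * D(mu) / D(0) (this    *)
(* ratio of determinants is the shifted Schur function of Okounkov-Olshanski).  *)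
(* Column operations kill the first row of D(mu) but one entry and give the     *)
(* branching rule that removes a horizontal strip from mu with weight the       *)
(* product of the lambda_1 - (content).  Iterating it over the rows of lambda,  *)
(* with every box weighted by u = 1/(4 max(s, n/sqrt k)), the first sqrt k rows  *)
(* of mu contribute geometric series of ratio at most 1/2 and the other rows    *)
(* finite sums bounded by (1 + u(lambda_1 + j))^(mu_j - mu_(j+1)); the total    *)
(* exponent is O(k) because the Durfee square of mu has side at most sqrt k.    *)

(** Write K for the number of standard tableaux of lambda/mu. Then K D(lambda) and (n-k)! D(mu) obey
    the same recursion, which adds one box to mu, so they are equal ([num_linear_extensions_fdet]).
    Dividing by the same identity for the empty partition eliminates D(lambda). What remains is an
    upper bound on D(mu) / D(0), obtained in [fdet_le] by induction on the number of rows of lambda.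
    [fdet_branch] deletes the first row of lambda together with a horizontal strip of mu, and
    [sum_strip_weight_le] and [prod_geom_le] bound the cost of one such step by an exponential.
    Finally [exp_le_ffact] trades n^k for the falling factorial at the price of e^k. *)

(** * Linear extensions of a finite relation *)

Section LinearExtensions.
Variables (T : finType) (e : rel T).
Hypothesis e_irr : irreflexive e.

(** An order of filling is kept as a word, so that deleting its first letter gives the recursion on
    minimal elements. *)
Definition linear_extension (A : {set T}) (w : seq T) :=
  [&& uniq w, [set c in w] == A & pairwise (fun c c' => ~~ e c' c) w].

Definition minimal_in (A : {set T}) (c : T) :=
  (c \in A) && [forall c' in A, ~~ e c' c].

Lemma linear_extension_cons (A : {set T}) c w :
  linear_extension A (c :: w) = minimal_in A c && linear_extension (A :\ c) w.
Proof.
rewrite /linear_extension /minimal_in /=; have [cw|cw] := boolP (c \in w); rewrite /=.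
  apply/esym; apply: contraTF cw => /and4P[_ _ /eqP Aw _].
  by have := setD11 c A; rewrite -Aw inE => ->.
have -> : ([set x in c :: w] == A) = (c \in A) && ([set x in w] == A :\ c).
  rewrite set_cons; apply/eqP/andP => [<-|[cA /eqP ->]]; last exact: setD1K.
  split; first by rewrite setU11.
  by rewrite setU1K // inE.
case: (boolP (c \in A)) => cA; rewrite ?andbF //= .
have [/eqP Aw|] := boolP ([set x in w] == A :\ c); last by rewrite !andbF.
have -> : all (fun c' => ~~ e c' c) w = [forall c' in A, ~~ e c' c].
  apply/allP/forall_inP => h c'.
    have [->|c'c] := eqVneq c' c; first by rewrite e_irr.
    by move=> c'A; apply: h; have := in_setD1 c' A c; rewrite -Aw inE c'c c'A.
  by move=> c'w; apply: h; have := in_setD1 c' A c; rewrite -Aw inE c'w => /esym/andP[].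
by rewrite /= andbCA.
Qed.

Definition num_linear_extensions m (A : {set T}) :=
  #|[set w : m.-tuple T | linear_extension A w]|.

Lemma num_linear_extensions0 A : num_linear_extensions 0 A = (A == set0).
Proof.
rewrite /num_linear_extensions; case: eqVneq => [->|A0] /=.
  rewrite -(cards1 ([tuple] : 0.-tuple T)); apply: eq_card => w.
  by rewrite !inE tuple0 eqxx /linear_extension /= andbT; apply/eqP/setP => c; rewrite !inE.
apply: eq_card0 => w; rewrite inE tuple0 /linear_extension /= andbT.
by apply: contra_neqF A0 => /eqP <-; apply/setP => c; rewrite !inE.
Qed.

Lemma num_linear_extensionsS m A :
  num_linear_extensions m.+1 A =
  \sum_(c | minimal_in A c) num_linear_extensions m (A :\ c).
Proof.
rewrite /num_linear_extensions.
transitivity (\sum_c \sum_(w : m.-tuple T) (minimal_in A c && linear_extension (A :\ c) w : nat)).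
  rewrite pair_bigA /= -sum1dep_card big_mkcond /=.
  rewrite (reindex (fun p : T * m.-tuple T => cons_tuple p.1 p.2)) /=.
    by apply: eq_bigr => p _; rewrite linear_extension_cons; case: (_ && _).
  exists (fun w : m.+1.-tuple T => (thead w, behead_tuple w)) => [[c w] _|w _] /=.
    by congr (_, _); apply: val_inj.
  by rewrite [RHS]tuple_eta; apply: val_inj.
rewrite [RHS]big_mkcond; apply: eq_bigr => c _; case: ifP => _; last exact: big1.
by rewrite -sum1dep_card [RHS]big_mkcond; apply: eq_bigr => w _; case: linear_extension.
Qed.

(** A filling corresponds to the word that lists the boxes by increasing entry; conversely the entry
    of a box is its index in the word. *)
Lemma card_order_fillings (P : pred T) m :
  #|[set t : {ffun {c : T | P c} -> 'I_m} |
      [forall v : 'I_m, #|[set b | t b == v]| == 1]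
      && [forall b, forall b', e (val b) (val b') ==> (t b < t b')]]| =
  num_linear_extensions m [set c | P c].
Proof.
pose W := {w : m.-tuple T | linear_extension [set c | P c] w}.
have memW (w : W) c : (c \in val w) = P c.
  by case/and3P: (valP w) => _ /eqP/setP/(_ c); rewrite !inE.
have index_lt (w : W) (b : {c : T | P c}) : index (val b) (val w) < m.
  by have := index_mem (val b) (val w); rewrite size_tuple memW (valP b).
pose f (w : W) := [ffun b => Ordinal (index_lt w b)].
have f_inj : injective f.
  move=> w w' /ffunP ff; apply/val_inj/eq_from_tnth => i.
  have Pc : P (tnth (val w) i) by rewrite -(memW w) mem_tnth.
  have := congr1 val (ff (Sub _ Pc)); rewrite !ffunE /= => /esym.
  rewrite {2}(tnth_nth (tnth (val w) i)) index_uniq ?size_tuple //; last by case/and3P: (valP w).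
  move=> idx; rewrite (tnth_nth (tnth (val w) i) (val w')) -idx nth_index //.
  by rewrite memW.
transitivity #|f @: setT|; last first.
  by rewrite card_imset // cardsT card_sig /num_linear_extensions cardsE.
apply: eq_card => t; rewrite inE; apply/andP/imsetP => [[/forallP t1 /forallP tmono]|[w _ ->]].
  have /fin_all_exists[h th] (v : 'I_m) : exists b, t b = v.
    by have /cards1P[b /setP/(_ b)] := t1 v; rewrite !inE eqxx => /eqP; exists b.
  have ht b : h (t b) = b.
    have /cards1P[b0 /setP tb0] := t1 (t b).
    by move: (tb0 b) (tb0 (h (t b))); rewrite !inE th eqxx => /esym/eqP -> /esym/eqP.
  pose w := [tuple val (h v) | v < m].
  have wext : linear_extension [set c | P c] w.
    apply/and3P; split.
    - rewrite map_inj_uniq ?enum_uniq // => v v' /val_inj hv.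
      by rewrite -(th v) hv th.
    - apply/eqP/setP => c; rewrite !inE; apply/mapP/idP => [[v _ ->]|Pc].
        exact: valP (h v).
      by exists (t (Sub c Pc)); rewrite ?mem_enum // ht.
    - rewrite pairwise_map.
      have : pairwise ltn (map val (enum 'I_m)).
        by rewrite val_enum_ord -(sorted_pairwise ltn_trans) iota_ltn_sorted.
      rewrite pairwise_map; apply: sub_pairwise => v v' vv'; apply/negP => ehh.
      have /forallP/(_ (h v))/implyP/(_ ehh) := tmono (h v').
      by rewrite !th ltnNge (ltnW vv').
  exists (Sub w wext) => //; apply/ffunP => b; rewrite ffunE; apply: val_inj => /=.
  have h_inj : injective (fun v => val (h v)) by move=> v v' /val_inj hv; rewrite -(th v) hv th.
  by rewrite -[in RHS](ht b) (index_map h_inj) index_enum_ord.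
have wuniq : uniq (val w) by case/and3P: (valP w).
split.
  apply/forallP => v; apply/cards1P.
  have Pc : P (tnth (val w) v) by rewrite -(memW w) mem_tnth.
  exists (Sub _ Pc); apply/setP => b; rewrite !inE ffunE -!val_eqE /=.
  rewrite (tnth_nth (val b)); apply/eqP/eqP => [<-|->].
    by rewrite nth_index // memW (valP b).
  by rewrite index_uniq ?size_tuple.
apply/forallP => b; apply/forallP => b'; apply/implyP => ebb'; rewrite !ffunE /=.
case/and3P: (valP w) => _ _ /(pairwiseP (val b)) pw.
rewrite ltnNge leq_eqVlt; apply/negP => /predU1P[h|h].
  have bw : val b \in val w by rewrite memW (valP b).
  by move: ebb'; rewrite -(nth_index (val b) bw) -h nth_index ?e_irr // memW (valP b').
have idx (b1 : {c | P c}) : index (val b1) (val w) \in gtn (size (val w)) by rewrite size_tuple; exact: index_lt.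
by have := pw _ _ (idx b') (idx b) h; rewrite !nth_index ?memW ?(valP b) ?(valP b') // ebb'.
Qed.

End LinearExtensions.

Local Open Scope ring_scope.

(** * Determinants *)

Section Det.
Variable R : comNzRingType.

(** In the Leibniz expansion each permutation pairs every a i with exactly one b k, so the sum of
    the differences does not depend on the permutation. *)
Lemma sum_det_scale_col r (M : 'M[R]_r) (a b : 'I_r -> R) :
  \sum_k \det (\matrix_(i, j) (M i j * (if j == k then a i - b k else 1))) =
  (\sum_i a i - \sum_j b j) * \det M.
Proof.
rewrite exchange_big mulr_sumr; apply: eq_bigr => s _ /=.
rewrite -mulr_sumr mulrCA; congr (_ * _).
rewrite (reindex_inj (@perm_inj _ s)) /=.
rewrite [X in _ = (_ - X) * _](reindex_inj (@perm_inj _ s)) /=.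
rewrite -sumrB mulr_suml; apply: eq_bigr => k _.
rewrite (bigD1 k) //= mxE eqxx [X in _ = _ * X](bigD1 k) //=.
rewrite (eq_bigr (fun i => M i (s i))); first by ring.
by move=> i ik; rewrite mxE (inj_eq perm_inj) (negPf ik) mulr1.
Qed.

Lemma det_scale_rows r (M : 'M[R]_r) (a : 'I_r -> R) :
  \det (\matrix_(i, j) (a i * M i j)) = (\prod_i a i) * \det M.
Proof.
rewrite mulr_sumr; apply: eq_bigr => s _.
rewrite mulrCA -big_split /=; congr (_ * _).
by apply: eq_bigr => i _; rewrite mxE.
Qed.

Lemma det_sum_cols r (B : finType) (c : 'I_r -> B -> R) (F : 'I_r -> 'I_r -> B -> R) :
  \det (\matrix_(i, j) \sum_q c j q * F i j q) =
  \sum_(f : {ffun 'I_r -> B})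
     (\prod_j c j (f j)) * \det (\matrix_(i, j) F i j (f j)).
Proof.
rewrite -det_tr; under eq_bigr do rewrite -det_tr mulr_sumr.
rewrite exchange_big; apply: eq_bigr => s _ /=.
under [RHS]eq_bigr do rewrite mulrCA; rewrite -mulr_sumr; congr (_ * _).
transitivity (\prod_j \sum_q c j q * F (s j) j q).
  by apply: eq_bigr => j _; rewrite !mxE.
rewrite bigA_distr_bigA; apply: eq_bigr => f _; rewrite big_split /=.
by congr (_ * _); apply: eq_bigr => j _; rewrite !mxE.
Qed.

(** Pigeonhole: the r - k rows from k on cannot be sent injectively into the r - k - 1 columns after
    k, so every Leibniz term meets the zero block. *)
Lemma det_block0 r (M : 'M[R]_r) (k : 'I_r) :
  (forall i j : 'I_r, (j <= k <= i)%N -> M i j = 0) -> \det M = 0.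
Proof.
move=> M0; apply: big1 => s _; suff [i ki sik] : exists2 i : 'I_r, (k <= i)%N & (s i <= k)%N.
  by rewrite (bigD1 i) //= M0 ?mul0r ?mulr0 // sik.
apply/exists_inP; apply: contraT; rewrite negb_exists_in => /forall_inP H.
pose P := [set i : 'I_r | (k <= i)%N].
have := subset_leq_card (_ : s @: P \subset P :\ k).
rewrite card_imset; last exact: perm_inj.
rewrite (cardsD1 k P) inE leqnn ltnn; apply.
apply/subsetP => _ /imsetP[i iP ->]; rewrite !inE in iP *.
by move: (H i iP); rewrite -ltnNge => h; rewrite -val_eqE neq_ltn h orbT ltnW.
Qed.

Lemma ffactr n m : (n ^_ m)%:R = \prod_(0 <= p < m) (n%:R - p%:R) :> R.
Proof.
elim: m => [|m IH]; first by rewrite big_geq.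
rewrite ffactnSr natrM big_nat_recr //= -IH; case: (leqP m n) => [mn|nm].
  by rewrite natrB.
by rewrite ffact_small // !mul0r.
Qed.

Lemma prod_sub_telescope (y z : R) a b :
  \prod_(a <= p < b) (y - p%:R) - \prod_(a <= p < b) (z - p%:R) =
  (y - z) * \sum_(a <= q < b)
     (\prod_(a <= p < q) (y - p%:R)) * \prod_(q.+1 <= p < b) (z - p%:R).
Proof.
elim: b => [|b IH]; first by rewrite !(big_geq (leq0n _)) subrr mulr0.
case: (leqP a b) => ab; last by rewrite !(big_geq ab) subrr mulr0.
rewrite 3?(big_nat_recr b) //= (big_geq (leqnn b.+1)) mulr1.
have -> : \sum_(a <= q < b) (\prod_(a <= p < q) (y - p%:R)) * \prod_(q.+1 <= p < b.+1) (z - p%:R)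
  = (z - b%:R) * \sum_(a <= q < b) (\prod_(a <= p < q) (y - p%:R)) * \prod_(q.+1 <= p < b) (z - p%:R).
  rewrite mulr_sumr; apply: eq_big_nat => q /andP[_ qb].
  by rewrite big_nat_recr //=; ring.
move: IH; set S := \sum_(a <= q < b) _ => /(canRL (subrK _)) ->; ring.
Qed.

End Det.

(** * Factorial determinants *)

(** This is D(v) for lambda = x. Shapes are functions on [nat], so that deleting the first row of x
    is just [x \o S]. *)
Definition fdet (R : comNzRingType) r (x v : nat -> nat) : R :=
  \det (\matrix_(i < r, j < r)
          ((x i + (r - i.+1)) ^_ (v j + (r - j.+1)))%:R).

Section Fdet.
Variable R : comNzRingType.

Lemma eq_fdet r (x y v w : nat -> nat) :
  (forall i, (i < r)%N -> x i = y i) -> (forall i, (i < r)%N -> v i = w i) ->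
  fdet R r x v = fdet R r y w.
Proof.
by move=> xy vw; congr (\det _); apply/matrixP => i j; rewrite !mxE xy ?vw.
Qed.

(** As [t ^_ b.+1] is [t ^_ b] times t - b, adding a box in row k scales the entries of column k by
    l_i - m_k. The staircase shifts cancel in the total. *)
Lemma fdet_pieri r (x v : nat -> nat) :
  \sum_(k < r) fdet R r x (fun j => (v j + (j == k))%N) =
  (\sum_(i < r) (x i)%:R - \sum_(i < r) (v i)%:R) * fdet R r x v.
Proof.
transitivity ((\sum_(i < r) (x i + (r - i.+1))%:R -
               \sum_(i < r) (v i + (r - i.+1))%:R) * fdet R r x v).
  rewrite -sum_det_scale_col; apply: eq_bigr => k _.
  congr (\det _); apply/matrixP => i j; rewrite !mxE.
  rewrite -val_eqE /=; case: (altP (_ =P _)) => [jk|_]; last by rewrite addn0 mulr1.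
  rewrite addn1 addSn ffactnSr natrM jk; set a := (x i + _)%N; set b := (v k + _)%N.
  case: (leqP b a) => ba; first by rewrite natrB.
  by rewrite ffact_small // !mul0r.
congr (_ * _); under eq_bigr do rewrite natrD.
by under [X in _ - X = _]eq_bigr do rewrite natrD; rewrite !big_split /=; ring.
Qed.

Lemma fdet_collision r (x v : nat -> nat) j :
  (j.+1 < r)%N -> v j.+1 = (v j).+1 -> fdet R r x v = 0.
Proof.
move=> jr vj; have j1r := ltnW jr.
rewrite /fdet -det_tr (@determinant_alternate _ _ _ (Ordinal j1r) (Ordinal jr)) //.
  by rewrite -val_eqE /= neq_ltn ltnSn.
move=> i; rewrite !mxE /= vj; congr (_ ^_ _)%:R; lia.
Qed.

Lemma fdet_outside r (x v : nat -> nat) k :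
  (k < r)%N -> (forall i j, (i <= j)%N -> x j <= x i)%N ->
  (forall j, (j <= k)%N -> v k <= v j)%N -> (x k < v k)%N -> fdet R r x v = 0.
Proof.
move=> kr xdec vdec xv; apply: (@det_block0 _ _ _ (Ordinal kr)) => i j /= /andP[jk ki].
rewrite mxE ffact_small //.
by move: (vdec _ jk) (xdec _ _ ki) (ltn_ord i) (ltn_ord j); lia.
Qed.

Definition ext0 r B (f : 'I_r -> 'I_B) (j : nat) : nat :=
  if insub j is Some i then f i else 0%N.

Lemma ext0E r B (f : 'I_r -> 'I_B) (i : 'I_r) : ext0 f i = f i.
Proof. by rewrite /ext0 valK. Qed.

Lemma ext0_ge r B (f : 'I_r -> 'I_B) j : (r <= j)%N -> ext0 f j = 0%N.
Proof. by move=> rj; rewrite /ext0 insubF // ltnNge rj. Qed.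

(* The factor contributed by row j when its boxes in columns q, ..., v j - 1 are removed. *)
Definition strip_weight (a : nat) (v : nat -> nat) (j q : nat) : R :=
  if (v j.+1 <= q <= v j)%N then \prod_(q <= p < v j) (a%:R + j%:R - p%:R) else 0.

(** The function f is the shape left after removing a horizontal strip. It ranges over all
    functions, with weight 0 off the strips, so that sums over f factor row by row. *)
Lemma fdet_branch r (x v : nat -> nat) B :
  (forall j, v j.+1 <= v j)%N -> (v 0%N < B)%N ->
  fdet R r.+1 x v =
  ((x 0%N + r) ^_ (v r))%:R
  * (\prod_(i < r) ((x 0%N + r)%:R - (x i.+1 + (r - i.+1))%:R))
  * \sum_(f : {ffun 'I_r -> 'I_B})
      (\prod_(j < r) strip_weight (x 0%N) v j (f j)) * fdet R r (x \o S) (ext0 f).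
Proof.
move=> vdec v0B.
have vB j : (v j < B)%N.
  by elim: j => // j; apply: leq_ltn_trans.
set l0 : R := (x 0%N + r)%:R.
pose l (i : nat) : R := (x i + (r - i))%:R.
pose m (j : nat) := (v j + (r - j))%N.
(* [A j] is the ratio of columns j and j+1 in the first row; subtracting [A j] times column j+1 from
   column j clears that row except for its last entry. *)
pose A (j : nat) : R := \prod_(m j.+1 <= p < m j) (l0 - p%:R).
pose M := \matrix_(i < r.+1, j < r.+1) (((x i + (r.+1 - i.+1)) ^_ (v j + (r.+1 - j.+1)))%:R : R).
pose U := \matrix_(k < r.+1, j < r.+1)
  ((k == j)%:R - (if k == j.+1 :> nat then A j else 0) : R).
have detU : \det U = 1.
  rewrite det_trig; last first.
    apply/is_trig_mxP => i j ij; rewrite mxE -val_eqE /= !ltn_eqF ?subrr //.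
    exact: ltnW.
  by apply: big1 => i _; rewrite mxE eqxx ltn_eqF ?subr0.
have MUE (i j : 'I_r.+1) : (M *m U) i j = M i j -
    (if unlift ord_max j is Some j' then A j' * M i (lift ord0 j') else 0).
  rewrite mxE; under eq_bigr do rewrite [U _ _]mxE mulrBr.
  rewrite sumrB; congr (_ - _).
    rewrite (bigD1 j) //= eqxx mulr1 big1 ?addr0 // => k /negPf kj.
    by rewrite kj mulr0.
  case: unliftP => [j' ->|->].
    under eq_bigr do rewrite lift_max.
    rewrite (bigD1 (lift ord0 j')) //= eqxx mulrC big1 ?addr0 // => k.
    by rewrite -val_eqE /= /bump /= add1n => /negPf ->; rewrite mulr0.
  by apply: big1 => k _ /=; rewrite ltn_eqF ?mulr0.
have Mfact (i j : 'I_r.+1) : M i j = ((x i + (r - i)) ^_ (m j))%:R.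
  by rewrite mxE !subSS.
have m_le j : (j < r)%N -> (m j.+1 < m j)%N.
  by rewrite /m; move: (vdec j); lia.
have Mstep (i : 'I_r.+1) (j : 'I_r) q : (m j.+1 <= q)%N ->
    M i (lift ord0 j) * \prod_(m j.+1 <= p < q) (l i - p%:R) = ((x i + (r - i)) ^_ q)%:R.
  move=> q1; rewrite Mfact /= !ffactr -big_cat_nat //=.
have bmp (j : 'I_r) : bump r j = j by exact: lift_max.
have MU0 (j : 'I_r) : (M *m U) ord0 (lift ord_max j) = 0.
  rewrite MUE liftK Mfact -(Mstep ord0 j) /=; last by rewrite bmp ltnW // m_le.
  by rewrite /A /l /= subn0 bmp mulrC subrr.
have MUS (i j : 'I_r) : (M *m U) (lift ord0 i) (lift ord_max j) =
    (l i.+1 - l0) *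
    \sum_(q < B) strip_weight (x 0%N) v j q * ((x i.+1 + (r - i.+1)) ^_ (q + (r - j.+1)))%:R.
  rewrite MUE liftK Mfact -(Mstep (lift ord0 i) j) /=; last first.
    by rewrite bmp ltnW // m_le.
  (* The telescoping index runs over m_(j+1) <= q < m_j; shifted by r - j - 1 this is v_(j+1) <= q
     <= v_j, the interlacing condition. *)
  rewrite bmp /bump /= add1n mulrC -mulrBl prod_sub_telescope -mulrA; congr (_ * _).
  rewrite mulr_suml.
  rewrite -(big_mkord xpredT (fun q => strip_weight (x 0%N) v j q * ((x i.+1 + (r - i.+1)) ^_ (q + (r - j.+1)))%:R)).
  rewrite [RHS](@big_cat_nat _ _ _ (v j).+1) //=.
  rewrite [X in _ = _ + X]big_nat_cond [X in _ = _ + X]big1 ?addr0; last first.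
    move=> q /andP[/andP[q1 _] _]; rewrite /strip_weight [(q <= _)%N]leqNgt q1 andbF.
    by rewrite mul0r.
  rewrite [RHS](@big_cat_nat _ _ _ (v j.+1)) //=; last by rewrite leqW.
  rewrite [X in _ = X + _]big_nat_cond [X in _ = X + _]big1 ?add0r; last first.
    move=> q /andP[/andP[_ q1] _]; rewrite /strip_weight [(_ <= q)%N]leqNgt q1.
    by rewrite mul0r.
  have -> : m j.+1 = (v j.+1 + (r - j.+1))%N by [].
  have -> : m j = ((v j).+1 + (r - j.+1))%N by rewrite /m; move: (ltn_ord j); lia.
  rewrite big_addn addnK; apply: eq_big_nat => q /andP[q1 q2].
  rewrite /strip_weight q1 -ltnS q2 -[X in _ = _ * X](Mstep (lift ord0 i) j) /=; last first.
    by rewrite /m leq_add2r.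
  have -> : \prod_(q <= p < v j) ((x 0%N)%:R + j%:R - p%:R) =
      \prod_((q + (r - j.+1)).+1 <= p < (v j).+1 + (r - j.+1)) (l0 - p%:R).
    rewrite -addSn big_addn addnK big_add1; apply: eq_bigr => p _.
    by rewrite /l0 !natrD (natrB _ (ltn_ord j)) -!natr1; ring.
  by rewrite -/(m j.+1) /bump /= add1n; ring.
transitivity (\det (M *m U)); first by rewrite det_mulmx detU mulr1.
rewrite (expand_det_row _ ord0) (bigD1 ord_max) //= big1 ?addr0; last first.
  move=> j jmax; case: (unliftP ord_max j) jmax => [j' ->|->]; last by rewrite eqxx.
  by rewrite MU0 mul0r.
rewrite MUE unlift_none subr0 Mfact /= /m subn0 subnn addn0 -mulrA; congr (_ * _).
rewrite /cofactor /= add0n.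
have -> : row' ord0 (col' ord_max (M *m U)) = \matrix_(i, j) ((l i.+1 - l0) *
   (\matrix_(i < r, j < r) \sum_(q < B) strip_weight (x 0%N) v j q * ((x i.+1 + (r - i.+1)) ^_ (q + (r - j.+1)))%:R) i j).
  by apply/matrixP => i j; rewrite !mxE -MUS !mxE.
rewrite det_scale_rows mulrA; congr (_ * _).
  (* The cofactor sign (-1)^r turns each l_i - l_0 into l_0 - l_i. *)
  rewrite -[X in (-1) ^+ X]card_ord -prodrN; apply: eq_bigr => i _; rewrite opprB.
  by [].
rewrite det_sum_cols; apply: eq_bigr => f _; congr (_ * _).
by congr (\det _); apply/matrixP => i j; rewrite !mxE ext0E.
Qed.

End Fdet.

(** * Upper bound by branching *)

Lemma muln_durfee_le d N (v : nat -> nat) :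
  (forall j, v j.+1 <= v j)%N -> (d <= N)%N -> (d * v d <= \sum_(j < N) v j)%N.
Proof.
move=> vdec dN; 
have vd i j : (i <= j)%N -> (v j <= v i)%N.
  by move=> ij; rewrite -(subnKC ij); elim: (j - i)%N => [|e IH]; rewrite ?addn0 // addnS (leq_trans _ IH).
apply: (@leq_trans (\sum_(j < d) v j)%N).
  by rewrite -{1}(card_ord d) -sum_nat_const; apply: leq_sum => i _; apply/vd/ltnW.
by rewrite -!(big_mkord xpredT v) [leqRHS](big_cat_nat (n := d)) //= leq_addr.
Qed.

(* Summation by parts turns the left-hand side into
   (a + d) * v d + \sum_(d < j <= N) v j, and d * v d <= \sum_(j < d) v j. *)
Lemma sum_by_parts_le d N a (v : nat -> nat) :
  (forall j, v j.+1 <= v j)%N -> (d <= N)%N ->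
  (\sum_(d <= j < N) (a + j) * (v j - v j.+1) + (a + N) * v N
     <= a * v d + \sum_(j < N.+1) v j)%N.
Proof.
move=> vdec; elim: N => [|N IH] dN.
  by move: dN; rewrite leqn0 => /eqP ->; rewrite big_geq // big_ord1; lia.
move: dN; rewrite leq_eqVlt => /predU1P[->|dN].
  rewrite big_geq // big_ord_recr /=; have := muln_durfee_le vdec (leqnn N.+1).
  by rewrite mulnDl big_ord_recr /=; move: (\sum_(j < N) _)%N (_ * _)%N (_ * _)%N; lia.
rewrite big_nat_recr //= big_ord_recr /=; have := IH dN.
rewrite -{1}(subnK (vdec N)) mulnDr addnS mulSn.
move: (\sum_(d <= j < N) _)%N (\sum_(j < N.+1) _)%N => s t; lia.
Qed.

Section Key.
Variable R : realType.
Implicit Types (u y : R).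

(** The sum is at most 1/(1 - y) <= 1 + 2y, whatever its length. *)
Lemma geom_le_expR y n : 0 <= y -> y <= 2^-1 -> \sum_(i < n) y ^+ i <= expR (2 * y).
Proof.
move=> y0 y2; apply: le_trans (expR_ge1Dx _).
have := subrX1 y n; have := exprn_ge0 n y0.
by set S := \sum_(i < n) _ => h e; nra.
Qed.

Lemma geom_le_expRM y n : 0 <= y -> \sum_(i < n.+1) y ^+ i <= expR (n%:R * y).
Proof.
move=> y0; apply: (@le_trans _ _ ((1 + y) ^+ n)); last first.
  by rewrite expRM_natl lerXn2r ?nnegrE ?expR_ge0 ?addr_ge0 // expR_ge1Dx.
elim: n => [|n IH]; first by rewrite big_ord1.
rewrite big_ord_recr /= [leRHS]exprSr mulrDr mulr1 lerD // exprSr ler_wpM2r //.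
by rewrite lerXn2r ?nnegrE ?addr_ge0 // lerDr.
Qed.

Lemma strip_weight_ge0 a (v : nat -> nat) j q : (v j <= a + j)%N -> 0 <= strip_weight R a v j q.
Proof.
move=> va; rewrite /strip_weight; case: ifP => // _.
rewrite big_nat_cond; apply: prodr_ge0 => p /andP[/andP[_ pv] _].
by rewrite -natrD subr_ge0 ler_nat; apply: leq_trans va; apply: ltnW.
Qed.

Lemma prod_row_le (a j b v q : nat) : (v <= a + j)%N -> (a + j <= b)%N ->
  \prod_(q <= p < v) (a%:R + j%:R - p%:R) <= b%:R ^+ (v - q) :> R.
Proof.
move=> va ab; rewrite -prodr_const_nat [leLHS]big_nat_cond [leRHS]big_nat_cond.
apply: ler_prod => p /andP[/andP[_ pv] _]; rewrite -natrD.
rewrite subr_ge0 ler_nat (leq_trans (ltnW pv)) //= lerBlDr -natrD ler_nat.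
by rewrite (leq_trans ab) // leq_addr.
Qed.

(** The empty shape has only the empty strip; iterating this gives the Vandermonde product of the
    l_i - l_j, i < j. *)
Lemma fdet0_branch r (x : nat -> nat) :
  fdet R r.+1 x (fun=> 0%N) =
  (\prod_(i < r) ((x 0%N + r)%:R - (x i.+1 + (r - i.+1))%:R)) * fdet R r (x \o S) (fun=> 0%N).
Proof.
rewrite (@fdet_branch _ _ _ _ 1) // mul1r; congr (_ * _).
rewrite (bigD1 [ffun=> ord0]) //= [X in _ + X]big1 ?addr0; last first.
  move=> f /negP[]; apply/eqP/ffunP => i; rewrite ffunE; exact: ord1.
rewrite big1 ?mul1r; last first.
  by move=> i _; rewrite /strip_weight ffunE /= big_geq.
by apply: eq_fdet => // i ir; rewrite (ext0E _ (Ordinal ir)) ffunE.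
Qed.

Lemma fdet0_gt0 r (x : nat -> nat) :
  (forall i j, (i <= j)%N -> x j <= x i)%N -> 0 < fdet R r x (fun=> 0%N).
Proof.
elim: r x => [|r IH] x xdec; first by rewrite /fdet det_mx00.
rewrite fdet0_branch mulr_gt0 //; last by apply: IH => i j ij; apply: xdec.
apply: prodr_gt0 => i _; rewrite subr_gt0 ltr_nat.
by case: i => i ir; have := xdec 0%N i.+1 isT; rewrite /=; lia.
Qed.

(* A partition of size at most k has Durfee square of side at most d. *)
Variables (k d : nat) (u : R).
Hypotheses (kd : (k < d.+1 ^ 2)%N) (u0 : 0 <= u).

(** Cost of deleting a row of length a from lambda: the first term pays for the first d rows of mu,
    the second for the rows below them. *)
Definition row_exponent (a : nat) : R :=
  2 * u * (a + d)%:R * d%:R + u * (a * d + k)%:R.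

Lemma prod_geom_le (a r : nat) (v : nat -> nat) :
  u * (a + d)%:R <= 2^-1 -> (forall j, v j.+1 <= v j)%N -> v r.+1 = 0%N ->
  (\sum_(j < r.+1) v j <= k)%N ->
  \prod_(j < r.+1) \sum_(i < (v j - v j.+1).+1) (u * (a + j)%:R) ^+ i
    <= expR (row_exponent a).
Proof.
move=> ua vdec vr vk.
(* The long rows get a bound independent of their length; the others get one proportional to v_j -
   v_(j+1), which is then summed by parts. *)
pose e (j : nat) : R := if (j < d)%N then 2 * (u * (a + d)%:R)
  else (v j - v j.+1)%:R * (u * (a + j)%:R).
have ge0 (j : nat) : 0 <= u * (a + j)%:R by rewrite mulr_ge0.
apply: (@le_trans _ _ (\prod_(j < r.+1) expR (e j))).
  apply: ler_prod => j _; rewrite sumr_ge0 => [|i _]; last exact: exprn_ge0.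
  rewrite /= /e; case: ltnP => jd; last exact: geom_le_expRM.
  have h : u * (a + j)%:R <= u * (a + d)%:R.
    by rewrite ler_wpM2l // ler_nat leq_add2l ltnW.
  apply: le_trans (geom_le_expR _ (ge0 _) (le_trans h ua)) _.
  by rewrite ler_expR ler_wpM2l.
rewrite -expR_sum ler_expR -(big_mkord xpredT e).
have e_lt n : (n <= d)%N -> \sum_(0 <= j < n) e j = n%:R * (2 * (u * (a + d)%:R)).
  move=> nd; rewrite -[n in n%:R]subn0 mulr_natl -sumr_const_nat.
  by apply: eq_big_nat => j /andP[_ jn]; rewrite /e (leq_trans jn nd).
have h0 : 0 <= 2 * (u * (a + d)%:R) by rewrite mulr_ge0.
have row0 : 0 <= u * (a * d + k)%:R by rewrite mulr_ge0.
rewrite /row_exponent; case: (leqP r.+1 d) => rd.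
  rewrite e_lt // ler_wpDr // mulrC -!mulrA ler_wpM2l // ler_wpM2l // ler_wpM2l // ler_nat //.
rewrite (big_cat_nat (n := d)) ?(ltnW rd) //= e_lt // lerD //.
  by rewrite mulrC !mulrA.
have -> : \sum_(d <= j < r.+1) e j = u * (\sum_(d <= j < r.+1) (a + j) * (v j - v j.+1))%:R.
  rewrite natr_sum mulr_sumr; apply: eq_big_nat => j /andP[dj _].
  by rewrite /e ltnNge dj /= natrM; ring.
rewrite ler_wpM2l // ler_nat.
have := sum_by_parts_le a vdec (ltnW rd); rewrite vr muln0 addn0 big_ord_recr /= vr addn0.
(* Otherwise a square of side d+1 would fit in v, against k < (d+1)^2. *)
have vd : (v d <= d)%N.
  rewrite leqNgt; apply/negP => dv.
  have : (d.+1 * d.+1 <= k)%N.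
    apply: leq_trans vk; rewrite -(big_mkord xpredT v) (big_cat_nat (n := d.+1)) //=.
    rewrite big_mkord (leq_trans _ (leq_addr _ _)) // big_ord_recr /=.
    have := leq_mul (leqnn d.+1) dv; have := muln_durfee_le vdec (leqnn d).
    move: (\sum_(i < d) _)%N (v d) => s t; nia.
  by rewrite leqNgt mulnn kd.
move=> h; exact: leq_trans h (leq_add (leq_mul (leqnn a) vd) vk).
Qed.

Lemma sum_strip_weight_le (a j B : nat) (v : nat -> nat) :
  (v j <= a + j)%N -> (v j.+1 <= v j)%N ->
  \sum_(q < B) u ^+ (v j - q) * strip_weight R a v j q
    <= \sum_(i < (v j - v j.+1).+1) (u * (a + j)%:R) ^+ i.
Proof.
move=> va vdec.
have y0 : 0 <= u * (a + j)%:R by rewrite mulr_ge0.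
pose F q := if (v j.+1 <= q <= v j)%N then (u * (a + j)%:R) ^+ (v j - q) else 0.
apply: (@le_trans _ _ (\sum_(q < B) F q)).
  apply: ler_sum => q _; rewrite /F /strip_weight; case: ifP => _; last by rewrite mulr0.
  by rewrite exprMn ler_wpM2l ?exprn_ge0 // prod_row_le.
have -> : \sum_(i < (v j - v j.+1).+1) (u * (a + j)%:R) ^+ i = \sum_(v j.+1 <= q < (v j).+1) F q.
  rewrite -[v j.+1 in RHS]add0n big_addn subSn // big_mkord (reindex_inj rev_ord_inj) /=.
  apply: eq_bigr => i _; have iv := ltn_ord i; rewrite /F leq_addl ifT; last by lia.
  congr (_ ^+ _); lia.
rewrite -(big_mkord xpredT F).
have F0 q : 0 <= F q by rewrite /F; case: ifP => // _; rewrite exprn_ge0.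
have [Bv|vB] := leqP B (v j).+1.
  apply: (@le_trans _ _ (\sum_(0 <= q < (v j).+1) F q)).
    by rewrite [leRHS](big_cat_nat (n := B)) //= lerDl sumr_ge0.
  rewrite (big_cat_nat (n := v j.+1)) ?leqW //= big_nat_cond big1 ?add0r //.
  by move=> q /andP[/andP[_ qv] _]; rewrite /F leqNgt qv.
rewrite (big_cat_nat (n := (v j).+1)) ?(ltnW vB) //= [X in _ + X]big_nat_cond.
rewrite [X in _ + X]big1 ?addr0; last first.
  by move=> q /andP[/andP[qv _] _]; rewrite /F [(q <= _)%N]leqNgt qv andbF.
rewrite (big_cat_nat (n := v j.+1)) ?leqW //= big_nat_cond big1 ?add0r //.
by move=> q /andP[/andP[_ qv] _]; rewrite /F leqNgt qv.
Qed.

(** Neither containment of v in x nor size exactly k is assumed: a shape left by a strip may stick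
    out of the remaining rows of x, and it may have fewer than k boxes. *)
Lemma fdet_le r (x v : nat -> nat) :
  (forall i j, (i <= j)%N -> x j <= x i)%N -> (forall j, v j.+1 <= v j)%N ->
  (forall j, (r <= j)%N -> v j = 0%N) -> (\sum_(j < r) v j <= k)%N ->
  u * (x 0%N + d)%:R <= 2^-1 ->
  u ^+ (\sum_(j < r) v j) * fdet R r x v
    <= fdet R r x (fun=> 0%N) * expR (\sum_(i < r) row_exponent (x i)).
Proof.
elim: r x v => [|r IH] x v xdec vdec v0 vk ux.
  by rewrite !big_ord0 expR0 mulr1 /fdet !det_mx00 mul1r.
(* If v sticks out of the first row, the determinant vanishes; otherwise all strip weights are
   nonnegative. *)
have [xv|vx] := ltnP (x 0%N) (v 0%N).
  rewrite (@fdet_outside _ _ _ _ 0) ?mulr0 //; last by move=> j; rewrite leqn0 => /eqP ->.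
  by rewrite mulr_ge0 ?expR_ge0 // ltW // fdet0_gt0.
have vx_all j : (v j <= x 0%N)%N.
  by elim: j => // j; apply: leq_trans.
rewrite (@fdet_branch _ _ _ _ (v 0%N).+1) // fdet0_branch.
set P := \prod_(i < r) _; set T := fdet R r _ (fun=> 0%N).
have P0 : 0 <= P.
  apply: prodr_ge0 => i _; rewrite subr_ge0 ler_nat.
  by case: i => i ir; have := xdec 0%N i.+1 isT; rewrite /=; lia.
have T0 : 0 < T by apply: fdet0_gt0 => i j ij; apply: xdec.
rewrite [leLHS](_ : _ = P * ((u ^+ v r * ((x 0%N + r) ^_ v r)%:R) *
   (u ^+ (\sum_(j < r) v j) *
   \sum_(f : {ffun 'I_r -> 'I_(v 0%N).+1})
      (\prod_(j < r) strip_weight R (x 0%N) v j (f j)) * fdet R r (x \o S) (ext0 f)))); last first.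
  by rewrite big_ord_recr /= exprD; ring.
rewrite -[leRHS]mulrA ler_wpM2l //.
rewrite big_ord_recl expRD; set E := expR (\sum_(i < r) _).
(* The last row of v is removed entirely, as the smaller determinant has only r rows; its factor is
   dominated by the top term of the geometric sum. *)
have last_le : u ^+ v r * ((x 0%N + r) ^_ v r)%:R <=
    \sum_(i < (v r - v r.+1).+1) (u * (x 0%N + r)%:R) ^+ i.
  rewrite (v0 r.+1) // subn0 big_ord_recr /= ler_wpDl //.
    by apply: sumr_ge0 => i _; rewrite exprn_ge0 ?mulr_ge0.
  rewrite exprMn ler_wpM2l ?exprn_ge0 // ffactr.
  have := @prod_row_le (x 0%N) r (x 0%N + r) (v r) 0 _ (leqnn _).
  by rewrite subn0 natrD; apply; rewrite (leq_trans (vx_all _)) ?leq_addr.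
have rest_le : u ^+ (\sum_(j < r) v j) *
   (\sum_(f : {ffun 'I_r -> 'I_(v 0%N).+1})
      (\prod_(j < r) strip_weight R (x 0%N) v j (f j)) * fdet R r (x \o S) (ext0 f)) <=
   (\prod_(j < r) \sum_(i < (v j - v j.+1).+1) (u * (x 0%N + j)%:R) ^+ i) * (T * E).
  apply: (@le_trans _ _ (\prod_(j < r) (\sum_(q < (v 0%N).+1) u ^+ (v j - q) * strip_weight R (x 0%N) v j q) * (T * E))); last first.
    rewrite ler_wpM2r ?mulr_ge0 ?expR_ge0 ?(ltW T0) //.
    apply: ler_prod => j _; rewrite sumr_ge0 => [|q _]; last first.
      by rewrite mulr_ge0 ?exprn_ge0 // strip_weight_ge0 // (leq_trans (vx_all _)) ?leq_addr.
    by rewrite sum_strip_weight_le // (leq_trans (vx_all _)) ?leq_addr.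
  rewrite bigA_distr_bigA /= mulr_suml mulr_sumr; apply: ler_sum => f _.
  have [inter|] := boolP [forall j : 'I_r, (v j.+1 <= f j <= v j)%N]; last first.
    rewrite negb_forall => /existsP[j nj].
    rewrite [X in _ * (X * _)](bigD1 j) //= [X in _ <= X * _](bigD1 j) //= /strip_weight (negPf nj).
    by rewrite !(mul0r, mulr0).
  have {}inter (j : 'I_r) : (v j.+1 <= f j <= v j)%N by apply/forallP: j.
  (* Split the powers of u between the removed boxes, which join the strip weights, and the
     remaining ones, which go to the induction hypothesis. *)
  have -> : (\sum_(j < r) v j = \sum_(j < r) (v j - f j) + \sum_(j < r) ext0 f j)%N.
    rewrite -big_split /=; apply: eq_bigr => j _; rewrite ext0E subnK //.
    by case/andP: (inter j).
  rewrite exprD big_split /= expr_sum -!mulrA; apply: ler_wpM2l.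
    by apply: prodr_ge0 => j _; rewrite exprn_ge0.
  rewrite mulrCA; apply: ler_wpM2l.
    by apply: prodr_ge0 => j _; rewrite strip_weight_ge0 // (leq_trans (vx_all _)) ?leq_addr.
  apply: IH.
  - by move=> i j ij; apply: xdec.
  - move=> j; case: (ltnP j.+1 r) => jr; last by rewrite ext0_ge.
    rewrite (ext0E f (Ordinal jr)) (ext0E f (Ordinal (ltnW jr))).
    case/andP: (inter (Ordinal jr)) => _; case/andP: (inter (Ordinal (ltnW jr))) => + _ /=.
    by move=> h1 h2; apply: leq_trans h2 h1.
  - by move=> j; apply: ext0_ge.
  - apply: leq_trans vk; rewrite big_ord_recr /= (leq_trans _ (leq_addr _ _)) //.
    by apply: leq_sum => j _; rewrite ext0E; case/andP: (inter j).
  - apply: le_trans ux; rewrite ler_wpM2l // ler_nat leq_add2r /=; exact: xdec.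
apply: (@le_trans _ _ ((\prod_(j < r.+1) \sum_(i < (v j - v j.+1).+1) (u * (x 0%N + j)%:R) ^+ i) * (T * E))); last first.
  rewrite mulrCA ler_wpM2l ?(ltW T0) // ler_wpM2r ?expR_ge0 //.
  by apply: prod_geom_le => //; apply: v0.
rewrite big_ord_recr /= [leRHS]mulrAC [leRHS]mulrC.
apply: le_trans (ler_wpM2l _ rest_le) _; first by rewrite mulr_ge0 ?exprn_ge0.
apply: ler_wpM2r last_le; rewrite !mulr_ge0 ?expR_ge0 ?(ltW T0) //.
by apply: prodr_ge0 => j _; apply: sumr_ge0 => i _; rewrite exprn_ge0 ?mulr_ge0.
Qed.

End Key.

(** * Counting skew tableaux *)

Section Counting.
Variables (a b : nat).

Definition box_before (c c' : 'I_a * 'I_b) : bool :=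
  ((c.1 == c'.1 :> nat) && (c.2 < c'.2)%N) || ((c.2 == c'.2 :> nat) && (c.1 < c'.1)%N).

Lemma box_before_irr : irreflexive box_before.
Proof. by move=> c; rewrite /box_before !ltnn !andbF. Qed.

Definition boxes_between (v x : nat -> nat) : {set 'I_a * 'I_b} :=
  [set c : 'I_a * 'I_b | (v c.1 <= c.2 < x c.1)%N].

Variable x : nat -> nat.
Hypothesis xdec : forall i j, (i <= j)%N -> (x j <= x i)%N.
Hypothesis xb : (x 0%N <= b)%N.

Let minimal (v : nat -> nat) := minimal_in box_before (boxes_between v x).

(** The minimal boxes of x/v are the corners that can be added to v inside x, one at most in each
    row. *)
Lemma minimal_boxE (v : nat -> nat) (k : 'I_a) (j : 'I_b) :
  (forall i j, (i <= j)%N -> (v j <= v i)%N) ->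
  minimal v (k, j) =
  [&& (v k < x k)%N, (k == 0 :> nat) || (v k < v k.-1)%N & j == v k :> nat].
Proof.
move=> vdec; rewrite /minimal /minimal_in inE /=.
apply/andP/and3P => [[/andP[vj jx] /forall_inP cmin]|[vx kv /eqP jv]].
  have vb : (v k < b)%N by apply: leq_ltn_trans vj (ltn_ord j).
  have jv : (j : nat) = v k.
    apply/eqP; rewrite eqn_leq vj andbT leqNgt; apply/negP => h.
    have := cmin (k, Ordinal vb); rewrite inE /= leqnn (leq_ltn_trans vj jx) => /(_ isT).
    by rewrite /box_before /= eqxx h.
  split; [by rewrite -jv| |by rewrite jv].
  have [//|k0] := eqVneq (k : nat) 0%N; rewrite /= ltnNge; apply/negP => h.
  have k1 : (k.-1 < a)%N by rewrite (leq_ltn_trans (leq_pred _)).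
  have := cmin (Ordinal k1, j); rewrite inE /= jv h /=.
  rewrite -jv (leq_trans jx) ?xdec ?leq_pred // => /(_ isT).
  by rewrite /box_before /= eqxx prednK ?lt0n // leqnn orbT.
rewrite jv leqnn vx; split=> //; apply/forall_inP => -[k' j'].
rewrite inE /= => /andP[vj' _]; rewrite /box_before /= jv; apply/negP.
case/orP => /andP[/eqP e]; first by rewrite -e ltnNge vj'.
move=> k'k; case/orP: kv => [/eqP k0|]; first by rewrite k0 in k'k.
rewrite ltnNge (leq_trans (vdec k' k.-1 _)) // -?e // -ltnS prednK //.
exact: leq_ltn_trans k'k.
Qed.

Lemma num_linear_extensions_fdet (R : comNzRingType) m (v : nat -> nat) :
  (forall i j, (i <= j)%N -> (v j <= v i)%N) -> (forall j, v j <= x j)%N ->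
  (\sum_(i < a) (x i - v i))%N = m ->
  (num_linear_extensions box_before m (boxes_between v x))%:R * fdet R a x x
    = m`!%:R * fdet R a x v.
Proof.
elim: m v => [|m IH] v vdec vx sm.
  have vxE i : (i < a)%N -> x i = v i.
    move=> ia; apply/eqP; rewrite eqn_leq vx andbT -subn_eq0.
    by move/eqP: sm; rewrite sum_nat_eq0 => /forallP/(_ (Ordinal ia)).
  rewrite num_linear_extensions0 (_ : _ == set0); last first.
    apply/eqP/setP => c; rewrite !inE vxE // ltnNge andbN //.
  by rewrite !mul1r; apply: eq_fdet.
rewrite num_linear_extensionsS; last exact: box_before_irr.
pose w k := fun j => (v j + (j == k))%N.
transitivity (\sum_(c | minimal v c) m`!%:R * fdet R a x (w c.1)).
  rewrite natr_sum mulr_suml; apply: eq_bigr => -[k j].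
  rewrite -/(minimal v (k, j)) minimal_boxE // => /and3P[vxk kv /eqP jv] /=.
  rewrite -IH.
  - congr (_%:R * _); congr num_linear_extensions; apply/setP => -[k' j'].
    rewrite !inE /= /w xpair_eqE -!val_eqE /=.
    by have [->|kk'] := eqVneq (k' : nat) k; rewrite ?addn0 //= jv addn1; lia.
  - move=> i i' ii'; rewrite /w.
    have [i'k|_] := eqVneq i' (k : nat); last by rewrite addn0 (leq_trans (vdec _ _ ii')) ?leq_addr.
    have [->|ik] := eqVneq i i'; first by rewrite i'k eqxx.
    have i'i : (i < k)%N by rewrite -i'k ltn_neqAle ik ii'.
    rewrite i'k addn1 (leq_trans _ (leq_addr _ _)) //.
    case/orP: kv => [/eqP k0|kv]; first by rewrite k0 in i'i.
    by apply: leq_trans kv (vdec _ _ _); rewrite -ltnS prednK // (leq_ltn_trans _ i'i).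
  - move=> i; rewrite /w; have [->|_] := eqVneq i (k : nat); last by rewrite addn0.
    by rewrite addn1.
  - move: sm; rewrite (bigD1 k) //= [in X in _ -> X](bigD1 k) //= {1}/w eqxx.
    rewrite [in X in _ -> X](eq_bigr (fun i : 'I_a => x i - v i)%N); last first.
      by move=> i ik; rewrite /w (_ : (i == k :> nat) = false) ?addn0 //; apply: negPf.
    by move: (\sum_(i | _) _)%N; lia.
rewrite -mulr_sumr factS natrM [_.+1%:R * _]mulrC -mulrA; congr (_ * _).
have -> : m.+1%:R = \sum_(i < a) (x i)%:R - \sum_(i < a) (v i)%:R :> R.
  rewrite -sumrB -sm natr_sum; apply: eq_bigr => i _; exact: natrB.
rewrite -fdet_pieri -/w.
rewrite (eq_bigl (fun c => xpredT c.1 && minimal v (c.1, c.2))); last by case.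
rewrite -(pair_big_dep xpredT (fun k j => minimal v (k, j)) (fun k _ => fdet R a x (w k))) /=.
apply: eq_bigr => k _.
under eq_bigl do rewrite minimal_boxE //.
(* The terms of [fdet_pieri] that match no minimal box vanish: here v + e_k is not a partition and
   two columns coincide. *)
have [kv|kv] := boolP ((k == 0 :> nat) || (v k < v k.-1)%N); last first.
  rewrite big_pred0 => [|j]; last by rewrite andbF.
  move: kv; rewrite negb_or -lt0n -leqNgt => /andP[k0 kv].
  have vk : v k.-1 = v k by apply/eqP; rewrite eqn_leq kv vdec ?leq_pred.
  apply/esym/(@fdet_collision _ _ _ _ k.-1); first by rewrite prednK.
  by rewrite /w prednK // eqxx vk addn1 ltn_eqF ?addn0 // -ltnS prednK.
(* Here v + e_k leaves x, which creates a zero block. *)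
have [vxk|xvk] /= := ltnP (v k) (x k); last first.
  rewrite big_pred0_eq (@fdet_outside _ _ _ _ k) //; last by rewrite /w eqxx addn1.
  move=> j jk; rewrite /w eqxx; have [->//|jk'] := eqVneq j (k : nat).
  have {jk jk'} jk : (j < k)%N by rewrite ltn_neqAle jk' jk.
  case/orP: kv => [/eqP k0|kv]; first by rewrite k0 in jk.
  by rewrite addn0 addn1 (leq_trans kv) // vdec // -ltnS prednK // (leq_ltn_trans _ jk).
have vb : (v k < b)%N by rewrite (leq_trans vxk) // (leq_trans (xdec (leq0n k))).
by rewrite (big_pred1 (Ordinal vb)).
Qed.

End Counting.

Lemma num_skew_sytE (lam mu : seq nat) :
  num_skew_syt lam mu =
  num_linear_extensions (@box_before (size lam) (head 0%N lam)) (sumn lam - sumn mu)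
    (boxes_between _ _ (nth 0%N mu) (nth 0%N lam)).
Proof.
rewrite /num_skew_syt.
transitivity (num_linear_extensions (@box_before (size lam) (head 0%N lam)) (sumn lam - sumn mu)
   [set c : 'I_(size lam) * 'I_(head 0%N lam) | (val c.1, val c.2) \in skew_diagram lam mu]); last first.
  congr num_linear_extensions; apply/setP => c.
  by rewrite !inE /= -leqNgt andbC.
rewrite -card_order_fillings; last exact: box_before_irr.
apply: eq_card => t; rewrite !inE /is_standard; congr (_ && _).
apply/andP/forallP => [[/forallP hr /forallP hc] b|h].
  apply/forallP => b'; apply/implyP => /orP[bb'|bb'].
    by have /forallP/(_ b')/implyP := hr b; apply.
  by have /forallP/(_ b')/implyP := hc b; apply.
split; apply/forallP => b; apply/forallP => b'; apply/implyP => bb'.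
  by have /forallP/(_ b')/implyP := h b; apply; apply/orP; left.
by have /forallP/(_ b')/implyP := h b; apply; apply/orP; right.
Qed.

Lemma sum_nth_sumn (s : seq nat) N : (size s <= N)%N ->
  (\sum_(j < N) nth 0 s j)%N = sumn s.
Proof.
elim: s N => [|y s IH] [|N] //= sN; try by rewrite big1 // => j _; rewrite nth_nil.
by rewrite big_ord_recl /= IH.
Qed.

(** Factor by factor, n (k - i) <= (n - i) k because k <= n. *)
Lemma expn_fact_le_ffact n k : (k <= n)%N -> (n ^ k * k`! <= n ^_ k * k ^ k)%N.
Proof.
move=> kn; have : (\prod_(i < k) (n * (k - i)) <= \prod_(i < k) ((n - i) * k))%N.
  by apply: leq_prod => i _; rewrite mulnBr mulnBl leq_sub2l // mulnC leq_mul.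
by rewrite !big_split /= !prod_nat_const !card_ord -!ffact_prod ffactnn.
Qed.

Lemma sqrt_floor k : exists d, (d * d <= k < d.+1 ^ 2)%N.
Proof.
elim: k => [|k [d /andP[dk kd]]]; first by exists 0%N.
have [h|h] := ltnP k.+1 (d.+1 ^ 2); first by exists d; rewrite h leqW.
by exists d.+1; rewrite -mulnn in kd h *; rewrite h /= -mulnn; nia.
Qed.

Lemma exp_le_ffact (R : realType) n k : (k <= n)%N ->
  n%:R ^+ k <= (n ^_ k)%:R * expR 1 ^+ k :> R.
Proof.
move=> kn; case: k kn => [|k] kn; first by rewrite ffactn0 !expr0 mulr1.
have f0 : 0 < (k.+1)`!%:R :> R by rewrite ltr0n fact_gt0.
rewrite -(ler_pM2r f0) -natrX -natrM.
apply: (@le_trans _ _ (n ^_ k.+1 * k.+1 ^ k.+1)%:R).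
  by rewrite ler_nat expn_fact_le_ffact.
rewrite natrM -mulrA ler_wpM2l // -expRM_natl mulr1 natrX -ler_pdivrMr //.
by apply: le_trans (expR_ge1Dxn k _); rewrite ?lerDr.
Qed.

Lemma max_hook_ge (s : seq nat) : (0 < head 0 s)%N ->
  (size s <= max_hook s)%N /\ (head 0 s <= max_hook s)%N.
Proof. by case: s => //= y s; rewrite /max_hook /=; lia. Qed.

Theorem theorem1p3 (R : realType) :
  exists C : R, 0 < C /\
    forall (n k : nat) (lam mu : seq nat),
      (1 <= n)%N -> (1 <= k <= n)%N ->
      is_partition_of n lam -> is_partition_of k mu ->
      {subset diagram mu <= diagram lam} ->
      (num_skew_syt lam mu)%:R / (num_syt lam)%:R
        <= (C * Num.max (1 / Num.sqrt k%:R) ((max_hook lam)%:R / n%:R)) ^+ k.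
Proof.
(* The 4 comes from u, e from [exp_le_ffact], and e^2 from the bound 2k on the total exponent. *)
exists (4 * expR 1 * expR 2); split; first by rewrite !mulr_gt0 ?expR_gt0.
move=> n k lam mu n1 /andP[k1 kn] /and3P[lam_sorted lam0 /eqP lamn].
move=> /and3P[mu_sorted mu0 /eqP muk] mulam.
set x := nth 0%N lam; set v := nth 0%N mu; set r := size lam.
have nth_dec s : sorted geq s -> forall i j, (i <= j)%N -> (nth 0 s j <= nth 0 s i)%N.
  move=> ss i j ij; have [sj|js] := leqP (size s) j; first by rewrite nth_default.
  have geq_trans : transitive geq by move=> y z t zy yt; apply: leq_trans yt zy.
  by apply: (sorted_leq_nth geq_trans leqnn 0%N ss) => //; rewrite inE // (leq_ltn_trans ij).
have xdec : forall i j, (i <= j)%N -> (x j <= x i)%N by apply: nth_dec.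
have vdec : forall i j, (i <= j)%N -> (v j <= v i)%N by apply: nth_dec.
have vx j : (v j <= x j)%N.
  rewrite leqNgt; apply/negP => xv.
  by have := mulam (j, x j); rewrite !inE /= ltnn => /(_ xv).
have v0 j : (r <= j)%N -> v j = 0%N.
  by move=> rj; apply/eqP; rewrite -leqn0 (leq_trans (vx j)) // /x nth_default.
have sx : (\sum_(i < r) x i = n)%N by rewrite sum_nth_sumn.
have sv : (\sum_(i < r) v i = k)%N.
  rewrite sum_nth_sumn // leqNgt; apply/negP => rmu.
  by have := mem_nth 0%N rmu; rewrite -/v v0 // (negPf mu0).
have xb : (x 0%N <= head 0%N lam)%N by rewrite /x nth0.
have x0 : x 0%N = head 0%N lam by rewrite /x nth0.
have Dgt0 := @fdet0_gt0 R r x xdec.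
have := @num_linear_extensions_fdet r _ x xdec xb R (n - k) v vdec vx.
have := @num_linear_extensions_fdet r _ x xdec xb R n (fun=> 0%N) (fun _ _ _ => isT) (fun _ => leq0n _).
rewrite (eq_bigr (fun i : 'I_r => x i)); last by move=> i _; rewrite subn0.
move=> /(_ sx) syt_lam.
have -> : (\sum_(i < r) (x i - v i) = n - k)%N.
  rewrite -sx -sv -[LHS](addnK (\sum_(i < r) v i)) -big_split /=; congr (_ - _)%N.
  by apply: eq_bigr => i _; rewrite subnK.
move=> /(_ erefl) syt_skew.
have nE : num_syt lam = num_linear_extensions (@box_before r (head 0%N lam)) n (boxes_between _ _ (fun=> 0%N) x).
  rewrite /num_syt num_skew_sytE lamn subn0; congr num_linear_extensions.
  by apply/setP => c; rewrite !inE nth_nil.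
rewrite nE num_skew_sytE lamn muk.
move: syt_lam syt_skew.
set N := num_linear_extensions _ n _; set K := num_linear_extensions _ (n - k) _.
set DL := fdet R r x x => syt_lam syt_skew.
(* D(lambda) is never computed: it is nonzero because N D(lambda) = n! D(0) > 0, and it cancels in
   the ratio. *)
have NDL : N%:R * DL != 0 by rewrite syt_lam mulf_neq0 ?gt_eqF // ltr0n fact_gt0.
have /andP[N0 DL0] : (N%:R != 0 :> R) && (DL != 0) by rewrite -negb_or -mulf_eq0.
have ratioE : K%:R / N%:R = (fdet R r x v / fdet R r x (fun=> 0%N)) / (n ^_ k)%:R.
  rewrite -(@mulfK _ DL DL0 K%:R) syt_skew -(@mulfK _ DL DL0 N%:R) syt_lam.
  rewrite -(ffact_fact kn) natrM.
  have f1 : ((n - k)`!)%:R != 0 :> R by rewrite pnatr_eq0 -lt0n fact_gt0.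
  have f2 : (n ^_ k)%:R != 0 :> R by rewrite pnatr_eq0 -lt0n ffact_gt0.
  by field; rewrite DL0 f1 f2 gt_eqF.
rewrite {}ratioE.
set M := Num.max _ _.
have n0 : 0 < n%:R :> R by rewrite ltr0n.
pose w : R := Num.sqrt k%:R.
have w0 : 0 < w by rewrite sqrtr_gt0 ltr0n.
have w2 : w * w = k%:R by rewrite -expr2 sqr_sqrtr.
have M1 : 1 <= w * M by rewrite -ler_pdivrMl // mulrC le_max -/w lexx.
have M2 : (max_hook lam)%:R <= n%:R * M by rewrite mulrC -ler_pdivrMr // le_max lexx orbT.
have M0 : 0 < M by rewrite lt_max -/w divr_gt0.
have [d /andP[dk kd]] := sqrt_floor k.
have dw : d%:R <= w.
  by rewrite -(ler_pXn2r (n := 2)) ?nnegrE ?(ltW w0) // !expr2 w2 -natrM ler_nat.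
(* Both lambda_1 and d are at most nM, so this u makes u (lambda_1 + d) at most 1/2. *)
pose u : R := (4 * (n%:R * M))^-1.
have Q0 : 0 < n%:R * M by rewrite mulr_gt0.
have u0 : 0 < u by rewrite invr_gt0 mulr_gt0.
have wQ : w <= n%:R * M.
  have : k%:R <= n%:R :> R by rewrite ler_nat.
  by rewrite -w2; nra.
have lam_nil : (0 < head 0%N lam)%N.
  rewrite -x0 lt0n; apply/eqP => x00; move: n1; rewrite -sx big1 // => i _.
  by apply/eqP; rewrite -leqn0 -x00 xdec.
have [rs xs] : (r <= max_hook lam)%N /\ (x 0%N <= max_hook lam)%N.
  rewrite x0; exact: max_hook_ge.
have rQ : r%:R <= n%:R * M by apply: le_trans M2; rewrite ler_nat.
have xQ : (x 0%N)%:R <= n%:R * M by apply: le_trans M2; rewrite ler_nat.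
have ux : u * (x 0%N + d)%:R <= 2^-1.
  by rewrite mulrC ler_pdivrMr ?mulr_gt0 // natrD; lra.
have := @fdet_le R k d u kd (ltW u0) r x v xdec (fun j => vdec _ _ (leqnSn j)) v0.
rewrite sv leqnn => /(_ isT ux) main.
(* The sum equals u (3nd + 2rd^2 + rk). Each of nd, rd^2 and rk is at most k nM, so the total is at
   most 6k/4. *)
have expo : \sum_(i < r) row_exponent k d u (x i) <= 2 * k%:R :> R.
  have -> : \sum_(i < r) row_exponent k d u (x i) =
      u * (2 * (n%:R + r%:R * d%:R) * d%:R + (n%:R * d%:R + r%:R * k%:R)).
    transitivity (\sum_(i < r) ((x i)%:R * (u * (3 * d%:R)) +
                                u * (2 * d%:R * d%:R + k%:R))).
      by apply: eq_bigr => i _; rewrite /row_exponent !natrD natrM; ring.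
    by rewrite big_split /= -mulr_suml -natr_sum sx sumr_const card_ord -mulr_natl; ring.
  rewrite mulrC ler_pdivrMr ?mulr_gt0 //.
  have d0 : 0 <= d%:R :> R by [].
  have nw : n%:R <= w * (n%:R * M) by nra.
  have dd : d%:R * d%:R <= k%:R :> R by rewrite -natrM ler_nat.
  have h1 : n%:R * d%:R <= k%:R * (n%:R * M).
    apply: le_trans (ler_pM (ltW n0) d0 nw dw) _.
    by rewrite -w2 mulrAC.
  have h2 : r%:R * d%:R * d%:R <= k%:R * (n%:R * M).
    by rewrite -mulrA mulrC ler_pM ?mulr_ge0.
  have h3 : r%:R * k%:R <= k%:R * (n%:R * M) by rewrite mulrC ler_wpM2l.
  have h4 : 0 <= k%:R * (n%:R * M) by rewrite mulr_ge0 // ltW.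
  by lra.
rewrite ler_pdivrMr ?ltr0n ?ffact_gt0 //.
rewrite ler_pdivrMr // -(ler_pM2l (exprn_gt0 k u0)).
apply: le_trans main _; rewrite mulrA mulrC ler_wpM2r ?(ltW Dgt0) //.
apply: (@le_trans _ _ (expR 2 ^+ k)).
  by rewrite -expRM_natl ler_expR mulrC.
have -> : u ^+ k * ((4 * expR 1 * expR 2 * M) ^+ k * (n ^_ k)%:R) =
    expR 2 ^+ k * ((n ^_ k)%:R * expR 1 ^+ k / n%:R ^+ k).
  rewrite mulrA -exprMn (_ : u * _ = expR 2 * expR 1 / n%:R).
    rewrite !exprMn exprVn; move: (n%:R ^+ k)^-1 (expR 2 ^+ k) (expR 1 ^+ k) => y1 y2 y3; ring.
  by rewrite /u; field; rewrite !gt_eqF.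
rewrite ler_peMr ?exprn_ge0 ?expR_ge0 // ler_pdivlMr ?exprn_gt0 // mul1r.
exact: exp_le_ffact.
Qed.
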